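(* Let $X$ be an infinite-dimensional complex Banach space that admits an unconditional, non-symmetric, normalized Schauder basis $(e_m)_{m\in\mathbb{N}}$. Then there exists a Schauder basis for $X$ that is not an $\mathcal{R}$-basis.
   Context: A Schauder basis of $X$ is a sequence $(e_m)_{m\in\mathbb{N}}$ such that every $x\in X$ has a unique norm-convergent expansion $x=\sum_{m=1}^\infty a_m e_m$; it is unconditional if for every $x$ this expansion converges unconditionally, and normalized if $\|e_m\|=1$ for all $m$. Two basic sequences $(e_m)$ and $(f_m)$ are equivalent if for each complex sequence $(a_m)$, $\sum a_m e_m$ converges if and only if $\sum a_m f_m$ converges. An unconditional basis $(e_m)_{m\in\mathbb{N}}$ is symmetric if it is equivalent to $(e_{\pi(m)})_{m\in\mathbb{N}}$ for every permutation $\pi$ of $\mathbb{N}$; otherwise it is non-symmetric. For a Schauder basis $(f_m)_{m\in\mathbb{N}}$ let $P_N(\sum_{m=1}^\infty a_m f_m)=\sum_{m=1}^N a_m f_m$, $N\in\mathbb{N}$. The basis is an $\mathcal{R}$-basis if $\{P_N: N\in\mathbb{N}\}$ is $\mathcal{R}$-bounded. $\mathcal{R}$-boundedness: let $r_k(\omega)=\operatorname{sign}\sin(2^k\pi\omega)$, $\omega\in[0,1]$. A family $\mathcal{T}\subset\mathcal{L}(X)$ is $\mathcal{R}$-bounded if for some (equivalently, all) $p\in[1,\infty)$ there is $C>0$ such that for all $n\in\mathbb{N}$, $T_1,\dots,T_n\in\mathcal{T}$ and $x_1,\dots,x_n\in X$ one has $\bigl(\int_0^1\|\sum_{k=1}^n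 r_k(\omega)T_kx_k\|^p d\omega\bigr)^{1/p}\le C\bigl(\int_0^1\|\sum_{k=1}^n r_k(\omega)x_k\|^p d\omega\bigr)^{1/p}$. *)

(* Defs.v *)
From HB Require Import structures.
From mathcomp Require Import all_boot all_order all_algebra.
From mathcomp Require Import all_classical all_reals all_analysis.
From mathcomp Require Import complex.

Set Implicit Arguments.
Unset Strict Implicit.
Unset Printing Implicit Defensive.

Import Order.TTheory GRing.Theory Num.Theory.
Import numFieldNormedType.Exports.

Local Open Scope classical_set_scope.
Local Open Scope ring_scope.

Section Defs.
Context {R : realType} {X : completeNormedModType R[i]}.

(* The norm of a normed module over R[i] takes its values in R[i]; it is a
   nonnegative real there, so its real part loses nothing. *)
Definition rnorm (x : X) : R := complex.Re `|x|.

Definition expansion (f : nat -> X) (x : X) (a : nat -> R[i]) : Prop :=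
  series (fun m => a m *: f m) @ \oo --> x.

(* Sequences start at index 0: f m is the (m+1)-st basis vector. *)
Definition schauder_basis (f : nat -> X) : Prop :=
  forall x, exists! a, expansion f x a.

Definition converges_unconditionally (u : nat -> X) : Prop :=
  forall pi : nat -> nat, bijective pi -> cvgn (series (u \o pi)).

Definition unconditional_basis (f : nat -> X) : Prop :=
  schauder_basis f /\
  forall x a, expansion f x a ->
    converges_unconditionally (fun m => a m *: f m).

Definition normalized (f : nat -> X) : Prop := forall m, `|f m| = 1.

Definition equivalent_seq (e f : nat -> X) : Prop :=
  forall a : nat -> R[i],
    cvgn (series (fun m => a m *: e m)) <->
    cvgn (series (fun m => a m *: f m)).

Definition symmetric_basis (e : nat -> X) : Prop :=
  unconditional_basis e /\
  forall pi : nat -> nat, bijective pi -> equivalent_seq e (e \o pi).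

(* The coefficient sequence of x; meaningful only when f is a Schauder basis,
   in which case the expansion exists and is unique. *)
Definition coefficients (f : nat -> X) (x : X) : nat -> R[i] :=
  xget (fun=> 0) (expansion f x).

Definition basis_proj (f : nat -> X) (N : nat) (x : X) : X :=
  \sum_(m < N) coefficients f x m *: f m.

Definition rademacher (k : nat) (w : R) : R := Num.sg (sin (2 ^+ k * pi * w)).

(* The L^p([0,1]; X) norm of r_1 x_1 + ... + r_n x_n, where x_k is x (k-1). *)
Definition rademacher_norm (p : R) (n : nat) (x : 'I_n -> X) : R :=
  (\int[lebesgue_measure]_(w in `[0, 1])
     rnorm (\sum_(k < n) (rademacher k.+1 w)%:C%C *: x k) `^ p) `^ p^-1.

(* Meant for families of bounded linear operators. The case n = 1 of the
   inequality already bounds every member of the family by C. *)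
Definition R_bounded (TT : set (X -> X)) : Prop :=
  exists2 p : R, 1 <= p & exists2 C : R, 0 < C &
    forall (n : nat) (T : 'I_n -> X -> X) (x : 'I_n -> X),
      (forall k, TT (T k)) ->
      rademacher_norm p (fun k => T k (x k)) <= C * rademacher_norm p x.

Definition R_basis (f : nat -> X) : Prop :=
  R_bounded [set basis_proj f N | N in [set N | (0 < N)%N]].

End Defs.

Definition infinite_dimensional {K : fieldType} (V : lmodType K) : Prop :=
  ~ exists (n : nat) (v : 'I_n -> V),
      forall x, exists c : 'I_n -> K, x = \sum_(i < n) c i *: v i.

(* Main.v *)
Require Import Defs.
From mathcomp Require Import all_boot all_order all_algebra.
From mathcomp Require Import all_classical all_reals all_analysis.
From mathcomp Require Import measurable_realfun complex.
From mathcomp Require Import zify ring lra.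

(** The theorem is proved by contraposition: if every Schauder basis of X is
    an R-basis, then the unconditional basis e is symmetric.

    Let S be a set of indices and p a permutation of the integers such that
    p maps S into its complement.  Enumerate the integers by a bijection rho
    in which each v in S comes immediately after p v, and replace e_v by
    e_v + e_(p v) for v in S.  The result f is again a Schauder basis
    [pair_schauder_basis]: its partial sums differ from those of the
    rearranged basis e o rho by a single vector e_(p v) whose coefficient
    tends to 0.  The projection of f that stops just before the vector
    e_v + e_(p v) sends e_v to - e_(p v) [pair_basis_proj], because
    e_v = (e_v + e_(p v)) - e_(p v).

    If f is an R-basis, apply the R-boundedness inequality to the vectors
    a_v e_v and to these projections.  By unconditionality the choice of signs
    changes norms by at most a constant factor [signed_sum_le], so Rademacher
    averages are equivalent to plain sums, and one gets
      || sum_(v in S) a_v e_(p v) || <= C || sum_v a_v e_v ||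
    for finite sums, with C independent of a [R_basis_dominated].

    Apart from the fixed points of p, where there is nothing to prove, the
    integers split into four sets S of this kind: one separates the v with
    v < p v from those with p v < v, and in each case one splits further by
    the parity of the position of v in a maximal monotone run of its orbit
    [excedance_parity].  Adding up the five estimates, sum a_v e_(p v) is
    dominated by sum a_v e_v for every permutation p; with the inverse
    permutation this gives the equivalence of e and e o p.

    The analytic input is that the finite coordinate projections of an
    unconditional basis are uniformly bounded [unconditional_constant].  For a
    fixed x the finite partial sums of its expansion are bounded, since
    otherwise blocks of norm larger than 1 could be made consecutive by a
    permutation and the rearranged series would diverge.  Baire's theorem makes
    this uniform in x for approximants of x only, and the successive
    approximation argument of the open mapping theorem removes the
    approximation. *)

Set Implicit Arguments.
Unset Strict Implicit.
Unset Printing Implicit Defensive.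

Import Order.TTheory GRing.Theory Num.Theory.
Import numFieldNormedType.Exports.

(** * Enumerations of the natural numbers *)

Lemma injective_unbounded (g : nat -> nat) : injective g ->
  forall n, exists i, n <= g i.
Proof.
move=> g_inj n; apply: contrapT => small.
suff: size (map g (iota 0 n.+1)) <= size (iota 0 n).
  by rewrite size_map !size_iota ltnn.
apply: uniq_leq_size; first by rewrite map_inj_uniq ?iota_uniq.
move=> _ /mapP[i _ ->]; rewrite mem_iota /= add0n ltnNge.
by apply/negP => ni; apply: small; exists i.
Qed.

(** The range of key is an infinite set of integers, and counting its elements
    in increasing order is a bijection: r i is the number of keys smaller
    than key i.  More generally rk t counts the keys smaller than t, so that
    the indices with key below t are an initial segment of the enumeration. *)
Lemma enumerate_by_key (key : nat -> nat) : injective key ->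
  exists rho r rk : nat -> nat,
    [/\ cancel rho r, cancel r rho, forall i, rk (key i) = r i &
        forall i t, (r i < rk t) = (key i < t)].
Proof.
move=> key_inj.
pose used x := `[< exists i, key i = x >].
pose rk x := \sum_(y < x) used y.
have rkS x : rk x.+1 = rk x + used x by rewrite /rk big_ord_recr.
have rk_homo : {homo rk : x y / x <= y}.
  by apply: (homo_leq leqnn leq_trans) => x; rewrite rkS leq_addr.
have used_key i : used (key i) = true by apply/asboolP; exists i.
have rk_lt i t : (rk (key i) < rk t) = (key i < t).
  apply/idP/idP => [|/rk_homo]; last by rewrite rkS used_key addn1.
  by apply: contraTT; rewrite -!leqNgt; exact: rk_homo.
pose r i := rk (key i).
have r_inj : injective r.
  move=> i j rij; apply: key_inj.
  by have := rk_lt i (key j); have := rk_lt j (key i); rewrite /r in rij; lia.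
have r_surj n : exists i, r i = n.
  have large : exists x, n < rk x.
    have [i ni] := injective_unbounded r_inj n.
    by exists (key i).+1; rewrite rkS used_key addn1 ltnS.
  case: (ex_minnP large) => -[|x]; first by rewrite /rk big_ord0.
  rewrite rkS => nx xmin.
  have rkx : rk x <= n by rewrite leqNgt; apply/negP => /xmin; rewrite ltnn.
  case: (boolP (used x)) nx => [/asboolP[i key_i] /= ni|_ /=]; last by lia.
  by exists i; rewrite /r key_i; lia.
have [rho rhoK] := choice r_surj.
by exists rho, r, rk; split => // i; apply: r_inj; rewrite rhoK.
Qed.

(** Match each j in S with p j; both members of a pair get the smaller of the
    two as base, and keys 2 base and 2 base + 1, the odd one going to the
    member in S; an unmatched index is its own base.  Consecutive keys have
    consecutive ranks. *)
Lemma enumerate_pairs (p q : nat -> nat) (S : pred nat) :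
  cancel p q -> cancel q p -> (forall j, S j -> ~~ S (p j)) ->
  exists rho r : nat -> nat,
    [/\ cancel rho r, cancel r rho & forall j, S j -> r j = (r (p j)).+1].
Proof.
move=> pK qK SP.
pose mate j := if S j then p j else if S (q j) then q j else j.
have mateK : involutive mate.
  rewrite /mate => j; case: (boolP (S j)) => [Sj|nSj].
    by rewrite (negbTE (SP _ Sj)) pK Sj.
  by case: (boolP (S (q j))) => [Sqj|/negbTE nSqj];
    rewrite ?Sqj ?qK // (negbTE nSj) nSqj.
have S_mate j : S (mate j) = S j -> mate j = j.
  rewrite /mate; case: (boolP (S j)) => [/SP/negbTE->//|nSj].
  by case: ifP => // ->.
pose key j := (minn j (mate j)).*2 + S j.
have key_inj : injective key.
  move=> i j kij.
  have Sij : S i = S j by move: kij; rewrite /key; lia.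
  have minij : minn i (mate i) = minn j (mate j).
    by move: kij; rewrite /key Sij; lia.
  have [//|ij|ij|ij] : [\/ i = j, i = mate j, mate i = j | mate i = mate j].
  - by case: (leqP i (mate i)) minij; case: (leqP j (mate j)); lia ||
      (move=> ? ? ?; by [constructor 1 | constructor 2 | constructor 3 | constructor 4]).
  - by rewrite ij; apply: S_mate; rewrite -ij.
  - by rewrite -ij; apply/esym/S_mate; rewrite ij.
  - exact: (inv_inj mateK).
have [rho [r [rk [rhoK rK rk_key rk_lt]]]] := enumerate_by_key key_inj.
exists rho, r; split => // j Sj.
have key_j : key j = (key (p j)).+1.
  rewrite /key Sj (negbTE (SP _ Sj)).
  have -> : mate (p j) = j by rewrite -[RHS]mateK /mate Sj.
  by rewrite /mate Sj minnC; lia.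
have r_lt i k : (r i < r k) = (key i < key k) by rewrite -(rk_key k) rk_lt.
pose k := rho (r (p j)).+1.
have rkE : r k = (r (p j)).+1 by rewrite rhoK.
suff jk : j = k by rewrite -rkE -jk.
apply: key_inj; have := r_lt (p j) k; have := r_lt (p j) j; have := r_lt j k.
by rewrite rkE ltnS leqnn; lia.
Qed.

(** The parity of the number of steps in the descent k > q k > q (q k) > ...
    as long as it goes on; fuel bounds the number of steps, and k steps are
    always enough. *)
Fixpoint descent_parity (q : nat -> nat) (fuel k : nat) : bool :=
  if fuel is n.+1 then (q k < k) && ~~ descent_parity q n (q k) else false.

Lemma descent_parity_fuel q n m k : k <= n -> k <= m ->
  descent_parity q n k = descent_parity q m k.
Proof.
elim: n m k => [|n IHn] [|m] k //=; rewrite ?leqn0.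
- by move=> /eqP->.
- by move=> _ /eqP->.
- by move=> kn km; case: ltnP => //= qk; rewrite (IHn m) //; lia.
Qed.

(** If k < p k, then the descent from p k along the inverse of p starts with
    the step to k, so it is one step longer than the descent from k. *)
Lemma excedance_parity (p q : nat -> nat) : cancel p q ->
  exists h : pred nat, forall k, k < p k -> h (p k) = ~~ h k.
Proof.
move=> pK; exists (fun k => descent_parity q k k) => k kp.
rewrite -(@descent_parity_fuel q (p k).-1.+1) ?leqSpred //= pK kp /=.
by congr negb; apply: descent_parity_fuel; lia.
Qed.

(** Cut the integers into intervals [B i, B (i+1)), each containing the block
    s (B i), and reorder each interval so that its block comes first. *)
Lemma rearrange_blocks (s : nat -> seq nat) :
  (forall n, uniq (s n)) -> (forall n, {in s n, forall j, n <= j}) ->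
  exists2 rho : nat -> nat, bijective rho &
    forall N, exists m n i : nat,
      N <= m /\ perm_eq (map rho (index_iota m n)) (s i).
Proof.
move=> s_uniq s_ge.
pose next n := (maxn n (\max_(j <- s n) j)).+1.
pose B i := iter i next 0.
have s_next n j : j \in s n -> j < next n.
  by move=> jn; rewrite ltnS leq_max; apply/orP; right; apply: (leq_bigmax_seq (F := id)).
have B_lt i : B i < B i.+1 by rewrite /= /next ltnS leq_maxl.
have B_homo : {homo B : i j / i <= j} := homo_leq leqnn leq_trans (fun i => ltnW (B_lt i)).
have B_ge i : i <= B i by elim: i => // i IHi; exact: leq_ltn_trans IHi (B_lt i).
have /choice[b bP] : forall j, exists i, B i <= j < B i.+1.
  move=> j; have large : exists i, j < B i by exists j.+1; exact: B_ge.
  case: (ex_minnP large) => -[//|i] ji imin; exists i.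
  by rewrite ji andbT leqNgt; apply/negP => /imin; rewrite ltnn.
(* Within the keys from 2 B i to 2 B (i+1), the block of the interval occupies
   those below B i + B (i+1). *)
pose key j := (if j \in s (B (b j)) then B (b j) else B (b j).+1) + j.
have key_b j : B (b j) + B (b j) <= key j < B (b j).+1 + B (b j).+1.
  by have := bP j; rewrite /key; case: ifP => _; lia.
have key_s j : (key j < B (b j) + B (b j).+1) = (j \in s (B (b j))).
  by have := bP j; rewrite /key; case: ifP => _; lia.
have b_eq i j x : B i + B i <= x < B i.+1 + B i.+1 ->
    B j + B j <= x < B j.+1 + B j.+1 -> i = j.
  by move=> ix jx; have [ij|ij|//] := ltngtP i j; have := B_homo _ _ ij; lia.
have key_inj : injective key.
  move=> i j kij.
  have bij : b i = b j by apply: b_eq (key_b i) _; rewrite kij.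
  have := key_s i; rewrite kij bij key_s; rewrite /key bij in kij.
  by move=> sij; move: kij; rewrite sij; lia.
have [rho [r [rk [rhoK rK _ rk_lt]]]] := enumerate_by_key key_inj.
exists rho; first by exists r.
(* This i is so large that the index rho N has a key below 2 B i. *)
move=> N; pose i := (key (rho N)).+1.
exists (rk (B i + B i)), (rk (B i + B i.+1)), (B i); split.
  rewrite -[N]rhoK ltnW // rk_lt; have := B_ge i; rewrite /i; lia.
have rho_inj := can_inj rhoK.
apply: uniq_perm; rewrite ?map_inj_uniq ?iota_uniq // => j.
rewrite -[j]rK (mem_map rho_inj) mem_index_iota rK.
rewrite leqNgt !rk_lt -leqNgt; have kj := key_b j; have sj := key_s j.
apply/idP/idP => [ij|js].
  have bj : i = b j by apply: b_eq kj; have := B_lt i; lia.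
  by rewrite bj -sj -bj; case/andP: ij.
have ij : i = b j.
  have := s_ge _ _ js; have := s_next _ _ js; rewrite -[next _]/(B i.+1) => jn ji.
  have := bP j; have [lt|lt|//] := ltngtP i (b j);
    by have := B_homo _ _ lt; lia.
by rewrite ij sj -ij js andbT; move: kj; rewrite ij; lia.
Qed.

Local Open Scope classical_set_scope.
Local Open Scope ring_scope.

(** * Real-valued norms and completeness *)

Section RealNorm.
Context {R : realType}.

Definition cabs (z : R[i]) : R := complex.Re `|z|.

Lemma cabsE z : `|z| = (cabs z)%:C%C.
Proof. by rewrite /cabs RRe_real ?normr_real. Qed.

Lemma cabs_ge0 z : 0 <= cabs z.
Proof. by rewrite -ler0c -cabsE. Qed.

Lemma cabs_real (t : R) : cabs t%:C%C = `|t|.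
Proof. by rewrite /cabs normc_def /= expr0n addr0 sqrtr_sqr. Qed.

Lemma cabs_le_ReIm z : cabs z <= `|complex.Re z| + `|complex.Im z|.
Proof.
rewrite /cabs normc_def /= -[leRHS]ger0_norm ?addr_ge0 // -sqrtr_sqr.
rewrite ler_wsqrtr // sqrrD -!normrX !(ger0_norm (sqr_ge0 _)) addrAC.
by rewrite lerDl mulrn_wge0 // mulr_ge0.
Qed.

Lemma ReIm_le_cabs z : `|complex.Re z| <= cabs z /\ `|complex.Im z| <= cabs z.
Proof.
rewrite /cabs normc_def /= -!sqrtr_sqr.
by split; apply: ler_wsqrtr; rewrite ?lerDl ?lerDr sqr_ge0.
Qed.

End RealNorm.

Lemma cauchy_cvgn (K : numFieldType) (V : completeNormedModType K)
    (u : nat -> V) :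
  (forall eps, 0 < eps ->
     exists N, forall m n, (N <= m)%N -> (N <= n)%N -> `|u m - u n| < eps) ->
  cvgn u.
Proof.
move=> u_cauchy; apply/cauchy_cvgP/cauchy_ballP => eps eps0.
have [N NP] := u_cauchy _ eps0.
exists (u @` [set n | (N <= n)%N], u @` [set n | (N <= n)%N]) => /=.
  by split; exists N => // n /= Nn; exists n.
by move=> [_ _] /= [[m Nm <-] [n Nn <-]]; rewrite -ball_normE /=; exact: NP.
Qed.

(** Completeness of the complex numbers, reduced to that of the real and
    imaginary parts. *)
Lemma complex_cauchy (R : realType) (a : nat -> R[i]) :
  (forall eps, 0 < eps -> exists N, forall m n, (N <= m)%N -> (N <= n)%N ->
     cabs (a m - a n) < eps) ->
  exists b, forall eps, 0 < eps -> exists N, forall n, (N <= n)%N ->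
     cabs (b - a n) < eps.
Proof.
move=> a_cauchy.
have cvg_part (f : R[i] -> R) :
    (forall z w, f z - f w = f (z - w)) -> (forall z, `|f z| <= cabs z) ->
    exists l : R, forall eps, 0 < eps -> exists N, forall n, (N <= n)%N ->
      `|l - f (a n)| < eps.
  move=> fB f_le; have /cvg_ex[l fl] : cvgn (f \o a : nat -> R^o).
    apply: cauchy_cvgn => eps /a_cauchy[N NP]; exists N => m n Nm Nn.
    by rewrite /= fB; exact: le_lt_trans (f_le _) (NP _ _ Nm Nn).
  exists l => eps eps0; move/cvgrPdist_lt : fl => /(_ _ eps0)[N _ NP].
  by exists N => n Nn; exact: NP.
have [|z|x xP] := cvg_part (@complex.Re R); first by case=> ? ? [].
  by case: (ReIm_le_cabs z).
have [|z|y yP] := cvg_part (@complex.Im R); first by case=> ? ? [].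
  by case: (ReIm_le_cabs z).
exists (Complex x y) => eps eps0.
have [N NP] := xP _ (divr_gt0 eps0 (ltr0Sn _ 1)); have [M MP] := yP _ (divr_gt0 eps0 (ltr0Sn _ 1)).
exists (maxn N M) => n; rewrite geq_max => /andP[/NP Nn /MP Mn].
apply: le_lt_trans (cabs_le_ReIm _) _.
by rewrite [eps]splitr; case: (a n) Nn Mn => ? ? /= Nn Mn; exact: ltrD.
Qed.

Lemma half_pow_small (R : realType) (eps : R) :
  0 < eps -> exists N, 2^-1 ^+ N < eps.
Proof.
move=> eps0; exists (Num.Def.archi_bound eps^-1).
rewrite exprVn invf_plt ?posrE ?exprn_gt0 //; exact: upper_nthrootP.
Qed.

Section RNorm.
Context {R : realType} {X : completeNormedModType R[i]}.
Implicit Types (x y : X) (u : nat -> X).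

Lemma rnormE x : `|x| = (rnorm x)%:C%C.
Proof. by rewrite /rnorm RRe_real ?normr_real. Qed.

Lemma rnorm_ge0 x : 0 <= rnorm x.
Proof. by rewrite -ler0c -rnormE. Qed.

Lemma rnorm0 : rnorm (0 : X) = 0.
Proof. by rewrite /rnorm normr0. Qed.

Lemma rnorm_eq0 x : rnorm x = 0 -> x = 0.
Proof. by move=> x0; apply/normr0_eq0; rewrite rnormE x0. Qed.

Lemma rnormD x y : rnorm (x + y) <= rnorm x + rnorm y.
Proof. by rewrite -lecR rmorphD /= -!rnormE ler_normD. Qed.

Lemma rnormN x : rnorm (- x) = rnorm x.
Proof. by rewrite /rnorm normrN. Qed.

Lemma rnorm_distC x y : rnorm (x - y) = rnorm (y - x).
Proof. by rewrite -opprB rnormN. Qed.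

Lemma rnormB x y : rnorm (x - y) <= rnorm x + rnorm y.
Proof. by rewrite -(rnormN y) rnormD. Qed.

Lemma rnorm_triangle x y z : rnorm (x - z) <= rnorm (x - y) + rnorm (y - z).
Proof. by rewrite -[x - z](subrKA y) rnormD. Qed.

Lemma rnormZ (a : R[i]) x : rnorm (a *: x) = cabs a * rnorm x.
Proof. by apply: complexI; rewrite rmorphM /= -rnormE -cabsE -rnormE normrZ. Qed.

Lemma rnorm_sum (I : Type) (s : seq I) (P : pred I) (F : I -> X) :
  rnorm (\sum_(i <- s | P i) F i) <= \sum_(i <- s | P i) rnorm (F i).
Proof.
elim/big_ind2: _ => [|x a y b xa yb|//]; first by rewrite rnorm0.
exact: le_trans (rnormD _ _) (lerD xa yb).
Qed.

Lemma cvg_rnormP u x : u @ \oo --> x <->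
  forall eps, 0 < eps -> exists N, forall n, (N <= n)%N -> rnorm (x - u n) < eps.
Proof.
split=> [/cvgrPdist_lt ux eps eps0|ux].
  have [|N _ NP] := ux eps%:C%C; first by rewrite ltcR.
  by exists N => n Nn; rewrite -ltcR -rnormE; exact: NP.
apply/cvgrPdist_lt => eps eps0.
have epsE : eps = (complex.Re eps)%:C%C by rewrite RRe_real // gtr0_real.
have [|N NP] := ux (complex.Re eps); first by rewrite -ltcR -epsE.
by exists N => // n /= Nn; rewrite rnormE epsE ltcR; exact: NP.
Qed.

Lemma cauchy_rnorm_cvgn u :
  (forall eps, 0 < eps ->
     exists N, forall m n, (N <= m)%N -> (N <= n)%N -> rnorm (u m - u n) < eps) ->
  cvgn u.
Proof.
move=> u_cauchy; apply: cauchy_cvgn => eps eps0.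
have epsE : eps = (complex.Re eps)%:C%C by rewrite RRe_real // gtr0_real.
have [|N NP] := u_cauchy (complex.Re eps); first by rewrite -ltcR -epsE.
by exists N => m n Nm Nn; rewrite rnormE epsE ltcR; exact: NP.
Qed.

Lemma cvgn_rnorm_cauchy u : cvgn u -> forall eps, 0 < eps ->
  exists N, forall m n, (N <= m)%N -> (N <= n)%N -> rnorm (u m - u n) < eps.
Proof.
move=> /cvg_ex[x /cvg_rnormP ux] eps eps0.
have [N NP] := ux _ (divr_gt0 eps0 (ltr0Sn _ 1)).
exists N => m n Nm Nn; apply: le_lt_trans (rnorm_triangle _ x _) _.
by rewrite [eps]splitr ltrD ?(rnorm_distC _ x) // NP.
Qed.

(** Baire's theorem for a countable cover, in the form in which the open
    mapping theorem uses it: some A n is dense in a ball.  Otherwise one builds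
    nested balls of radius tending to 0, the (n+1)-st being disjoint from A n,
    and their common point lies in no A n. *)
Lemma baire_ball (A : nat -> set X) : (forall x, exists n, A n x) ->
  exists n x0 eps, 0 < eps /\
    forall y, rnorm (y - x0) < eps -> forall delta, 0 < delta ->
      exists z, A n z /\ rnorm (y - z) < delta.
Proof.
move=> A_cover; apply: contrapT => nowhere.
have step (p : nat * (X * R)) : exists q : X * R, 0 < p.2.2 ->
    [/\ 0 < q.2, q.2 <= p.2.2 / 2,
        forall z, rnorm (z - q.1) <= q.2 -> rnorm (z - p.2.1) < p.2.2 &
        forall z, A p.1 z -> q.2 < rnorm (z - q.1)].
  case: p => n [x eps] /=.
  have [eps0|] := ltP 0 eps; last by exists (x, eps).
  have [y [yx [delta [delta0 dP]]]] : exists y, rnorm (y - x) < eps /\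
      exists delta, 0 < delta /\ forall z, A n z -> delta <= rnorm (y - z).
    apply: contrapT => none; apply: nowhere; exists n, x, eps; split=> // y yx.
    move=> delta delta0; apply: contrapT => no_z; apply: none.
    exists y; split=> //; exists delta; split=> // z Az.
    by rewrite leNgt; apply/negP => yz; apply: no_z; exists z.
  pose d := Num.min delta (eps - rnorm (y - x)).
  have [d0 d_delta d_eps] : [/\ 0 < d, d <= delta & d <= eps - rnorm (y - x)].
    by rewrite lt_min delta0 subr_gt0 yx !ge_min !lexx orbT.
  exists (y, d / 2) => _ /=; split => [||z zy|z /dP].
  - by rewrite divr_gt0.
  - by have := rnorm_ge0 (y - x); lra.
  - by have := rnorm_triangle z y x; lra.
  - by rewrite rnorm_distC; lra.
have [f fP] := choice step.
pose p := fix p n := if n is m.+1 then f (m, p m) else (0, 1) : X * R.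
have p0 n : 0 < (p n).2 by elim: n => [|n IHn] //=; case: (fP (n, p n) IHn).
have p_half n : (p n).2 <= 2^-1 ^+ n.
  elim: n => [|n IHn] //=; case: (fP (n, p n) (p0 n)) => _ le_half _ _.
  by rewrite exprS; move: le_half => /=; lra.
have p_ball n m z : (n <= m)%N -> rnorm (z - (p m).1) <= (p m).2 ->
    rnorm (z - (p n).1) <= (p n).2.
  elim: m => [|m IHm]; first by rewrite leqn0 => /eqP->.
  rewrite leq_eqVlt => /predU1P[->//|nm] zm; apply: IHm => //.
  by case: (fP (m, p m) (p0 m)) => _ _ /(_ _ zm)/ltW.
have p_in n m : (n <= m)%N -> rnorm ((p m).1 - (p n).1) <= (p n).2.
  by move=> nm; apply: p_ball nm _; rewrite subrr rnorm0 ltW.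
have small eps : 0 < eps -> exists N, (p N).2 < eps.
  by move=> /half_pow_small[N Neps]; exists N; exact: le_lt_trans (p_half N) Neps.
have /cvg_ex[x /cvg_rnormP px] : cvgn (fun n => (p n).1).
  apply: cauchy_rnorm_cvgn => eps eps0.
  have [N Neps] := small _ (divr_gt0 eps0 (ltr0Sn _ 1)); exists N => m n Nm Nn.
  apply: le_lt_trans (rnorm_triangle _ (p N).1 _) _.
  rewrite [eps]splitr (rnorm_distC _ (p n).1).
  by apply: ltrD; apply: le_lt_trans Neps; exact: p_in.
have x_ball n : rnorm (x - (p n).1) <= (p n).2.
  apply/ler_addgt0Pl => eps eps0; have [N NP] := px _ eps0.
  apply: le_trans (rnorm_triangle _ (p (maxn N n)).1 _) _.
  by apply: lerD; [apply/ltW/NP/leq_maxl|apply/p_in/leq_maxr].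
have [n Anx] := A_cover x.
case: (fP (n, p n) (p0 n)) => _ _ _ /(_ x Anx).
by rewrite ltNge; have /= -> := x_ball n.+1.
Qed.
End RNorm.

(** * Expansions in a Schauder basis *)

Section Expansions.
Context {R : realType} {X : completeNormedModType R[i]}.
Implicit Types (x y : X) (f u : nat -> X) (a b : nat -> R[i]) (s : seq nat).

Lemma expansionP f x a : expansion f x a <->
  forall eps, 0 < eps -> exists N, forall n, (N <= n)%N ->
    rnorm (x - \sum_(0 <= m < n) a m *: f m) < eps.
Proof. exact: cvg_rnormP. Qed.

Lemma expansionD f x y a b : expansion f x a -> expansion f y b ->
  expansion f (x + y) (fun m => a m + b m).
Proof.
move=> xa yb; rewrite /expansion.
have -> : series (fun m => (a m + b m) *: f m) =
    series (fun m => a m *: f m) \+ series (fun m => b m *: f m).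
  by apply/funext => n; rewrite /series /= -big_split; apply: eq_bigr => m _; rewrite scalerDl.
exact: cvgD.
Qed.

Lemma expansionZ f c x a : expansion f x a ->
  expansion f (c *: x) (fun m => c * a m).
Proof.
move=> xa; rewrite /expansion.
have -> : series (fun m => (c * a m) *: f m) = c \*: series (fun m => a m *: f m).
  by apply/funext => n; rewrite /series /= scaler_sumr; apply: eq_bigr => m _; rewrite scalerA.
exact: cvgZr.
Qed.

Lemma expansion_finite f N a : (forall m, (N <= m)%N -> a m = 0) ->
  expansion f (\sum_(0 <= m < N) a m *: f m) a.
Proof.
move=> a0; apply/expansionP => eps eps0; exists N => n Nn.
rewrite (big_cat_nat (leq0n N) Nn) /= [X in _ - (_ + X)]big_nat [X in _ - (_ + X)]big1 => [|m /andP[/a0-> _]].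
  by rewrite addr0 subrr rnorm0.
by rewrite scale0r.
Qed.

Variables (f : nat -> X) (f_basis : schauder_basis f).

Lemma coefficientsP x : expansion f x (coefficients f x).
Proof. by apply: xgetPex; have [a [xa _]] := f_basis x; exists a. Qed.

Lemma coefficients_unique x a : expansion f x a -> coefficients f x = a.
Proof.
move=> xa; have [b [_ b_uniq]] := f_basis x.
by rewrite -(b_uniq _ xa) (b_uniq _ (@coefficientsP x)).
Qed.

Lemma coefficientsD x y m :
  coefficients f (x + y) m = coefficients f x m + coefficients f y m.
Proof.
by rewrite (coefficients_unique (expansionD (@coefficientsP x) (@coefficientsP y))).
Qed.

Lemma coefficientsZ c x m : coefficients f (c *: x) m = c * coefficients f x m.
Proof. by rewrite (coefficients_unique (expansionZ (c := c) (@coefficientsP x))). Qed.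

Lemma coefficientsB x y m :
  coefficients f (x - y) m = coefficients f x m - coefficients f y m.
Proof. by rewrite coefficientsD -scaleN1r coefficientsZ mulN1r. Qed.

Lemma coefficients_vec j m : coefficients f (f j) m = (m == j)%:R.
Proof.
have /(expansion_finite (f := f)) : forall m, (j.+1 <= m)%N -> (m == j)%:R = 0 :> R[i].
  by move=> k jk; rewrite gtn_eqF.
rewrite big_nat_recr //= eqxx scale1r big_nat big1 => [|k /andP[_ kj]]; last first.
  by rewrite ltn_eqF ?scale0r.
by rewrite add0r => /coefficients_unique->.
Qed.

(** Unlike the partial-sum projections, these use arbitrary finite sets of
    indices, which is what unconditionality controls; the order of s is
    immaterial. *)
Definition finite_proj s x := \sum_(j <- s) coefficients f x j *: f j.

Lemma finite_projD s x y : finite_proj s (x + y) = finite_proj s x + finite_proj s y.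
Proof.
by rewrite /finite_proj -big_split; apply: eq_bigr => j _; rewrite coefficientsD scalerDl.
Qed.

Lemma finite_projZ s c x : finite_proj s (c *: x) = c *: finite_proj s x.
Proof.
rewrite /finite_proj scaler_sumr; apply: eq_bigr => j _.
by rewrite coefficientsZ scalerA.
Qed.

Lemma finite_projB s x y : finite_proj s (x - y) = finite_proj s x - finite_proj s y.
Proof. by rewrite finite_projD -[- y]scaleN1r finite_projZ scaleN1r. Qed.

Lemma finite_proj0 s : finite_proj s 0 = 0.
Proof. by rewrite -[0 in LHS](subrr 0) finite_projB subrr. Qed.

End Expansions.
Arguments coefficientsP {R X f} f_basis x.


(** * The constant of an unconditional basis *)

Section UnconditionalConstant.
Context {R : realType} {X : completeNormedModType R[i]}.
Implicit Types (x y : X) (s : seq nat).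

Lemma sum_subset_le (F : nat -> R) s t : (forall j, 0 <= F j) -> uniq s -> uniq t ->
  {subset s <= t} -> \sum_(j <- s) F j <= \sum_(j <- t) F j.
Proof.
move=> F0 s_uniq t_uniq st; rewrite [leRHS](bigID (mem s)) /=.
rewrite -[X in _ <= X + _]big_filter.
have st_perm : perm_eq [seq j <- t | j \in s] s.
  apply: uniq_perm; rewrite ?filter_uniq // => j; rewrite mem_filter.
  by case: (boolP (j \in s)) => // /st.
by rewrite (perm_big _ st_perm) lerDl sumr_ge0.
Qed.

(** If the finite sums were unbounded, those far out would be unbounded too,
    so one could pick disjoint blocks of norm larger than 1; a rearrangement
    making each block consecutive violates the Cauchy criterion. *)
Lemma unconditional_bounded_sums (u : nat -> X) : converges_unconditionally u ->
  exists M, forall s, uniq s -> rnorm (\sum_(j <- s) u j) <= M.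
Proof.
move=> u_unc; apply: contrapT => unbounded.
have far N : exists s, [/\ uniq s, {in s, forall j, (N <= j)%N} &
    1 < rnorm (\sum_(j <- s) u j)].
  apply: contrapT => none; apply: unbounded.
  exists (\sum_(j <- iota 0 N) rnorm (u j) + 1) => s s_uniq.
  rewrite (bigID (fun j => (j < N)%N)) /= -[X in rnorm (X + _)]big_filter.
  rewrite -[X in rnorm (_ + X)]big_filter.
  apply: le_trans (rnormD _ _) (lerD _ _).
    apply: le_trans (rnorm_sum _ _ _) (sum_subset_le _ _ _ _).
    - by move=> j; exact: rnorm_ge0.
    - by rewrite filter_uniq.
    - exact: iota_uniq.
    - by move=> j; rewrite mem_filter mem_iota => /andP[].
  rewrite leNgt; apply/negP => large; apply: none.
  exists [seq j <- s | ~~ (j < N)%N]; split => //; first by rewrite filter_uniq.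
  by move=> j; rewrite mem_filter -leqNgt => /andP[].
have [s sP] := choice far.
have [|N|rho rho_bij blocks] := @rearrange_blocks s.
- by move=> N; case: (sP N).
- by case: (sP N).
have [N NP] := cvgn_rnorm_cauchy (u_unc _ rho_bij) ltr01.
have [m [n [i [Nm block]]]] := blocks N.
have [_ _] := sP i; rewrite -(perm_big _ block) /= big_map.
have [mn|nm] := leqP m n; last first.
  by rewrite big_geq ?rnorm0 ?ltr10 // ltnW.
have <- := sub_series_geq (u \o rho) mn.
by move/(lt_trans (NP n m (leq_trans Nm mn) Nm)); rewrite ltxx.
Qed.

Variables (e : nat -> X) (e_unc : unconditional_basis e) (e_norm : normalized e).
Let e_basis : schauder_basis e := e_unc.1.
Local Notation proj := (finite_proj e).

Lemma rnorm_basis j : rnorm (e j) = 1.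
Proof. by apply: complexI; rewrite -rnormE e_norm. Qed.

(** The sets of vectors whose finite projections are bounded by n cover X, so
    one of them is dense in a ball around some x0.  Translating the ball to
    the origin and rescaling it gives approximants of every x. *)
Lemma controlled_approximation : exists2 L, 0 < L &
  forall x delta, 0 < delta -> exists2 z, rnorm (x - z) < delta &
    forall s, uniq s -> rnorm (proj s z) <= L * rnorm x.
Proof.
pose A n := [set x | forall s, uniq s -> rnorm (proj s x) <= n%:R].
have A_cover x : exists n, A n x.
  have := unconditional_bounded_sums (e_unc.2 _ _ (coefficientsP e_basis x)).
  move=> [M MP]; exists (Num.Def.archi_bound M) => s /MP sM.
  exact: le_trans sM (ltW (archi_boundP (le_trans (rnorm_ge0 _) sM))).
have [n [x0 [eps [eps0 near_x0]]]] := baire_ball A_cover.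
(* Rescaled by t below, x has norm eps / 2, and the difference of two elements
   of A n has projections of norm at most 2 n; the 1 is there in case n = 0. *)
exists (4 * n%:R / eps + 1) => [|x delta delta0].
  by rewrite ltr_wpDl // divr_ge0 ?mulr_ge0 // ltW.
have [/rnorm_eq0->|] := eqVneq (rnorm x) 0.
  by exists 0; rewrite ?subrr ?rnorm0 // => s _; rewrite finite_proj0 // rnorm0 mulr0.
rewrite neq_lt ltNge rnorm_ge0 /= => x_gt0.
pose t := eps / (2 * rnorm x).
have t0 : 0 < t by rewrite divr_gt0 ?mulr_gt0.
have cabs_t : cabs t%:C%C = t by rewrite cabs_real gtr0_norm.
have cabs_tV : cabs (t^-1)%:C%C = t^-1 by rewrite cabs_real gtr0_norm ?invr_gt0.
have dt0 : 0 < delta * t / 2 := divr_gt0 (mulr_gt0 delta0 t0) (ltr0Sn _ 1).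
have [|z1 [A1 z1P]] := near_x0 (x0 + t%:C%C *: x) _ _ dt0.
  rewrite addrC addKr rnormZ cabs_t /t invfM mulrA mulfVK ?gt_eqF //; lra.
have [|z2 [A2 z2P]] := near_x0 x0 _ _ dt0; first by rewrite subrr rnorm0.
have tVt : t^-1 * t = 1 by rewrite mulVf // gt_eqF.
exists ((t^-1)%:C%C *: (z1 - z2)) => [|s s_uniq].
  have -> : x - (t^-1)%:C%C *: (z1 - z2) =
      (t^-1)%:C%C *: (((x0 + t%:C%C *: x) - z1) - (x0 - z2)).
    have -> (y : X) : x0 + y - z1 - (x0 - z2) = y - (z1 - z2).
      by rewrite (addrC x0) (addrAC y) opprB (addrC z2) addrA addrK opprB -addrA (addrC _ z2).
    by rewrite [RHS]scalerBr scalerA -rmorphM /= tVt scale1r.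
  rewrite rnormZ cabs_tV mulrC ltr_pdivrMr //.
  apply: le_lt_trans (rnormB _ _) _; lra.
rewrite finite_projZ // finite_projB // rnormZ cabs_tV.
have := rnormB (proj s z1) (proj s z2); have := A1 s s_uniq; have := A2 s s_uniq.
move=> n2 n1 le12; have le2n : rnorm (proj s z1 - proj s z2) <= 2 * n%:R by lra.
have -> : t^-1 = 2 * rnorm x / eps by rewrite invf_div.
have -> : (4 * n%:R / eps + 1) * rnorm x = 2 * rnorm x / eps * (2 * n%:R) + rnorm x.
  by ring.
rewrite -[leLHS]addr0 lerD ?rnorm_ge0 // ler_wpM2l // divr_ge0 ?(ltW eps0) //.
by rewrite mulr_ge0 // ltW.
Qed.

(** The projections are closed operators, uniformly in s: if w tends to x and
    its projections form a uniform Cauchy sequence, then the coefficients of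
    w n have limits b, the uniformity allows one to interchange limits and
    shows that b is an expansion of x, and by uniqueness b is the coefficient
    sequence of x. *)
Lemma finite_proj_closed (w : nat -> X) x : w @ \oo --> x ->
  (forall eps, 0 < eps -> exists N, forall m n, (N <= m)%N -> (N <= n)%N ->
     forall s, uniq s -> rnorm (proj s (w m - w n)) < eps) ->
  forall s eps, uniq s -> 0 < eps -> exists N, forall n, (N <= n)%N ->
    rnorm (proj s x - proj s (w n)) <= eps.
Proof.
move=> /cvg_rnormP wx w_cauchy.
have /choice[b bP] : forall j, exists bj, forall eps, 0 < eps ->
    exists N, forall n, (N <= n)%N -> cabs (bj - coefficients e (w n) j) < eps.
  move=> j; apply: complex_cauchy => eps /w_cauchy[N NP]; exists N => m n Nm Nn.
  have := NP m n Nm Nn [:: j] isT.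
  by rewrite finite_projB // /finite_proj !big_seq1 -scalerBl rnormZ rnorm_basis mulr1.
pose lim_proj s := \sum_(j <- s) b j *: e j.
have pointwise s eps : 0 < eps -> exists N, forall n, (N <= n)%N ->
    rnorm (lim_proj s - proj s (w n)) < eps.
  move: eps; elim: s => [|j s IHs] eps eps0.
    by exists 0%N => n _; rewrite /lim_proj /finite_proj !big_nil subrr rnorm0.
  have [N NP] := bP j _ (divr_gt0 eps0 (ltr0Sn _ 1)).
  have [M MP] := IHs _ (divr_gt0 eps0 (ltr0Sn _ 1)).
  exists (maxn N M) => n; rewrite geq_max => /andP[/NP Nn /MP Mn].
  rewrite /lim_proj /finite_proj !big_cons opprD addrACA -scalerBl.
  apply: le_lt_trans (rnormD _ _) _; rewrite [eps]splitr rnormZ rnorm_basis mulr1.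
  exact: ltrD.
have uniform eps : 0 < eps -> exists N, forall n, (N <= n)%N -> forall s, uniq s ->
    rnorm (lim_proj s - proj s (w n)) <= eps.
  move=> /w_cauchy[N NP]; exists N => n Nn s s_uniq.
  apply/ler_addgt0Pl => d d0; have [M MP] := pointwise s _ d0.
  apply: le_trans (rnorm_triangle _ (proj s (w (maxn M N))) _) _.
  rewrite -finite_projB //; apply: lerD; apply: ltW; first exact/MP/leq_maxl.
  by apply: NP => //; exact: leq_maxr.
have xb : expansion e x b.
  apply/expansionP => eps eps0.
  have eps3 : 0 < eps / 3 by rewrite divr_gt0.
  have [N1 N1P] := wx _ eps3; have [N2 N2P] := uniform _ eps3.
  pose n := maxn N1 N2.
  have [M MP] := (expansionP _ _ _).1 (coefficientsP e_basis (w n)) _ eps3.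
  exists M => k /MP wk; have xw := N1P n (leq_maxl _ _).
  have := N2P n (leq_maxr _ _) (index_iota 0 k) (iota_uniq _ _).
  rewrite /lim_proj /finite_proj rnorm_distC.
  have := rnorm_triangle x (w n) (\sum_(0 <= m < k) b m *: e m).
  have := rnorm_triangle (w n) (\sum_(0 <= m < k) coefficients e (w n) m *: e m)
    (\sum_(0 <= m < k) b m *: e m).
  by lra.
move=> s eps s_uniq /uniform[N NP]; exists N => n Nn.
by rewrite [proj s x]/finite_proj (coefficients_unique e_basis xb) NP.
Qed.

(** Successive approximation: x is the sum of vectors z_n whose projections are
    bounded by L |x| / 2^n, and the projections of x are the sums of theirs;
    the geometric series yields the constant 2 L. *)
Theorem unconditional_constant : exists2 K, 0 < K &
  forall s x, uniq s -> rnorm (proj s x) <= K * rnorm x.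
Proof.
have [L L0 approx] := controlled_approximation.
exists (2 * L) => [|s x s_uniq]; first by rewrite mulr_gt0.
have [x0|] := eqVneq (rnorm x) 0.
  by rewrite (rnorm_eq0 x0) finite_proj0 // !rnorm0 mulr0.
rewrite neq_lt ltNge rnorm_ge0 /=; set c := rnorm x => c0.
pose radius n := c * 2^-1 ^+ n.
have radius0 n : 0 < radius n by rewrite mulr_gt0 // exprn_gt0.
have radiusS n : radius n.+1 = radius n / 2 by rewrite /radius exprSr mulrA.
have /choice[z zP] : forall ny : nat * X, exists z, rnorm (ny.2 - z) < radius ny.1.+1 /\
    forall s, uniq s -> rnorm (proj s z) <= L * rnorm ny.2.
  by move=> [n y]; have [z yz zL] := approx y _ (radius0 n.+1); exists z.
(* rest n is the error x - (z_0 + ... + z_(n-1)), and w n its complement. *)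
pose rest := fix rest n := if n is m.+1 then rest m - z (m, rest m) else x.
have rest_le n : rnorm (rest n) <= radius n.
  by case: n => [|n]; [rewrite /radius mulr1|apply/ltW/(zP (n, rest n)).1].
pose w n := x - rest n.
have w_step n t : uniq t -> rnorm (proj t (w n.+1 - w n)) <= L * radius n.
  move=> t_uniq; have -> : w n.+1 - w n = z (n, rest n).
    by rewrite /w /= !opprB !addrA subrK addrC addKr.
  apply: le_trans ((zP (n, rest n)).2 t t_uniq) _.
  by rewrite ler_pM2l //; exact: rest_le.
have w_dist n m t : (n <= m)%N -> uniq t ->
    rnorm (proj t (w m - w n)) <= 2 * L * (radius n - radius m).
  move=> + t_uniq; elim: m => [|m IHm].
    by rewrite leqn0 => /eqP->; rewrite !subrr finite_proj0 // rnorm0 mulr0.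
  rewrite leq_eqVlt => /predU1P[->|/IHm nm].
    by rewrite !subrr finite_proj0 // rnorm0 mulr0.
  rewrite -(subrKA (w m)) finite_projD // radiusS.
  by apply: le_trans (rnormD _ _) _; have := w_step m t t_uniq; lra.
have radius_small eps : 0 < eps -> exists N, radius N < eps.
  move=> eps0; have [N NP] := half_pow_small (divr_gt0 eps0 c0).
  by exists N; rewrite /radius mulrC -ltr_pdivlMr.
have radius_homo n m : (n <= m)%N -> radius m <= radius n.
  by move=> nm; rewrite ler_pM2l // ler_wiXn2l ?invr_ge0 ?invf_le1 ?ler0n ?ler1n.
have wx : w @ \oo --> x.
  apply/cvg_rnormP => eps /radius_small[N NP]; exists N => n /radius_homo Nn.
  by rewrite /w subKr; exact: le_lt_trans (rest_le n) (le_lt_trans Nn NP).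
have w_cauchy eps : 0 < eps -> exists N, forall m n, (N <= m)%N -> (N <= n)%N ->
    forall t, uniq t -> rnorm (proj t (w m - w n)) < eps.
  move=> eps0; have [|N NP] := radius_small (eps / (4 * L)).
    by rewrite divr_gt0 ?mulr_gt0.
  exists N => m n Nm Nn t t_uniq.
  rewrite -(subrKA (w N)) finite_projD //; apply: le_lt_trans (rnormD _ _) _.
  have wm := w_dist N m t Nm t_uniq; have wn := w_dist N n t Nn t_uniq.
  rewrite (finite_projB _ _ (w N)) // rnorm_distC -finite_projB //.
  move: NP; rewrite ltr_pdivlMr ?mulr_gt0 // => NP.
  have := mulr_gt0 L0 (radius0 m); have := mulr_gt0 L0 (radius0 n).
  by lra.
apply/ler_addgt0Pl => eps eps0.
have [N NP] := finite_proj_closed wx w_cauchy s_uniq eps0.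
have := NP N (leqnn _); have := w_dist 0%N N s isT s_uniq.
have w0 : w 0%N = 0 by rewrite /w subrr.
have -> : radius 0%N = c by rewrite /radius mulr1.
rewrite w0 subr0.
have := rnormD (proj s x - proj s (w N)) (proj s (w N)); rewrite subrK.
by have := mulr_gt0 L0 (radius0 N); lra.
Qed.

End UnconditionalConstant.

(** * Rademacher averages *)

Section Rademacher.
Context {R : realType}.

Lemma rademacherE k (w : R) : rademacher k w =
  if 0 < sin (2 ^+ k * pi * w) then 1 else if sin (2 ^+ k * pi * w) < 0 then -1 else 0.
Proof. by rewrite /rademacher; case: sgrP. Qed.

(** A vector of Rademacher functions takes finitely many values, each on a
    measurable set, so no regularity of F is required. *)
Lemma measurable_rademacher (s : seq nat) (F : seq R -> R) :
  measurable_fun [set: R] (fun w => F [seq rademacher k w | k <- s]).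
Proof.
elim: s F => [|k s IHs] F /=; first exact: measurable_cst.
have sin_meas : measurable_fun [set: R] (fun w : R => sin (2 ^+ k * pi * w)).
  apply: (@measurableT_comp _ _ _ _ _ _ sin).
    by apply: continuous_measurable_fun; exact: continuous_sin.
  by apply: measurable_funM => //; exact: measurable_id.
under eq_fun => w do rewrite rademacherE.
have -> : (fun w : R => F ((if 0 < sin (2 ^+ k * pi * w) then 1 else
      if sin (2 ^+ k * pi * w) < 0 then -1 else 0) :: [seq rademacher i w | i <- s])) =
    (fun w : R => if 0 < sin (2 ^+ k * pi * w)
      then F (1 :: [seq rademacher i w | i <- s])
      else if sin (2 ^+ k * pi * w) < 0
      then F (-1 :: [seq rademacher i w | i <- s])
      else F (0 :: [seq rademacher i w | i <- s])).
  by apply/funext => w; case: ltgtP.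
apply: measurable_fun_ifT; first exact: measurable_fun_ltr.
  exact: (IHs (fun l => F (1 :: l))).
apply: measurable_fun_ifT; first exact: measurable_fun_ltr.
  exact: (IHs (fun l => F (-1 :: l))).
exact: (IHs (fun l => F (0 :: l))).
Qed.

Lemma sin_pi_eq0 (y : R) : 0 <= y -> sin (pi * y) = 0 -> y = (Num.truncn y)%:R.
Proof.
move=> y0; pose m := Num.truncn y; pose t := y - m%:R.
have /andP[t0 t1] : 0 <= t < 1.
  by have := truncn_itv y0; rewrite /t -natr1 -/m => ?; lra.
have -> : pi * y = pi * t + pi *+ m by rewrite /t -mulr_natr; ring.
rewrite (alternatingn (@sinDpi R)) => /eqP; rewrite mulf_eq0 signr_eq0 /= => /eqP sin0.
apply/eqP; rewrite -subr_eq0 -/t; move: t0; rewrite le_eqVlt => /predU1P[<-//|t0].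
have : 0 < sin (pi * t :> R).
  by apply: sin_gt0_pi; rewrite mulr_gt0 ?pi_gt0 //= -[ltRHS]mulr1 ltr_pM2l ?pi_gt0.
by rewrite sin0 ltxx.
Qed.

(** The zeros of the Rademacher functions on [0, 1] are dyadic rationals. *)
Lemma rademacher_neq0_ae :
  {ae @lebesgue_measure R, forall w, `[0, 1]%classic w -> forall k, rademacher k w != 0}.
Proof.
pose dyadic := \bigcup_(k in [set: nat]) range (fun m : nat => m%:R / 2 ^+ k : R).
have dyadic_countable : countable dyadic.
  apply: bigcup_countable => // k _.
  exact: sub_countable (card_image_le _ _) (countableP _).
exists dyadic; split.
- exact: countable_measurable dyadic_countable.
- exact: countable_lebesgue_measure0.
move=> w /= /not_implyP[]; rewrite in_itv /= => /andP[w0 _].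
move=> /existsNP[k /negP]; rewrite negbK /rademacher sgr_eq0 => /eqP sin0.
exists k => //; exists (Num.truncn (2 ^+ k * w)) => //=.
rewrite -sin_pi_eq0 ?mulr_ge0 ?exprn_ge0 //; first by rewrite mulrAC divff ?mul1r ?expf_neq0.
by rewrite mulrCA mulrA.
Qed.

Context {X : completeNormedModType R[i]}.

Definition rademacher_sum n (x : 'I_n -> X) (w : R) : X :=
  \sum_(k < n) (rademacher k.+1 w)%:C%C *: x k.

Section Bounds.
Variables (p : R) (p_ge1 : 1 <= p) (n : nat) (x : 'I_n -> X).
Local Notation mu := (@lebesgue_measure R).
Local Notation D := (`[0, 1]%classic : set R).
Let f w := rnorm (rademacher_sum x w) `^ p.

Let mD : measurable D. Proof. exact: measurable_itv. Qed.

Let muD : mu D = 1%:E.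
Proof. by rewrite lebesgue_measure_itv /= lte_fin ltr01 sube0. Qed.

Let measurable_f : measurable_fun [set: R] f.
Proof.
have := measurable_rademacher (iota 1 n)
  (fun l => rnorm (\sum_(k < n) (l`_k)%:C%C *: x k) `^ p).
congr measurable_fun; apply/funext => w; congr (rnorm _ `^ p).
by apply: eq_bigr => k _; rewrite (nth_map 0%N) ?size_iota // nth_iota.
Qed.

Let measurable_fD : measurable_fun D (EFin \o f).
Proof. by apply/measurable_EFinP; exact: measurable_funTS. Qed.

Let p_gt0 : 0 < p. Proof. exact: lt_le_trans ltr01 p_ge1. Qed.

Let rootK c : 0 <= c -> (c `^ p) `^ p^-1 = c.
Proof. by move=> c0; rewrite -powRrM divff ?powRr1 // gt_eqF. Qed.

Let integral_le c : (forall w, rnorm (rademacher_sum x w) <= c) -> 0 <= c ->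
  (\int[mu]_(w in D) (f w)%:E <= (c `^ p)%:E)%E.
Proof.
move=> fc c0; have -> : (c `^ p)%:E = (\int[mu]_(w in D) cst (c `^ p)%:E w)%E.
  by rewrite integral_cst // -[LHS]mule1; congr (_ * _)%E; exact/esym/muD.
apply: ge0_le_integral => // [w _|w _]; rewrite lee_fin ?powR_ge0 //.
by apply: ge0_ler_powR; rewrite ?nnegrE ?rnorm_ge0 // ltW.
Qed.

Let integral_fin : (\int[mu]_(w in D) (f w)%:E)%E \is a fin_num.
Proof.
rewrite ge0_fin_numE; last by apply: integral_ge0 => w _; rewrite lee_fin powR_ge0.
apply: le_lt_trans (ltry _); apply: (@integral_le (\sum_(k < n) rnorm (x k))).
  move=> w; apply: le_trans (rnorm_sum _ _ _) (ler_sum _ _) => k _.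
  rewrite rnormZ cabs_real ler_piMl ?rnorm_ge0 //.
  by rewrite rademacherE; case: ifP => _; rewrite ?normr1 //; case: ifP; rewrite ?normrN1 ?normr0.
by rewrite sumr_ge0 // => k _; exact: rnorm_ge0.
Qed.

Lemma rademacher_norm_le c : 0 <= c ->
  (forall w, rnorm (rademacher_sum x w) <= c) -> rademacher_norm p x <= c.
Proof.
move=> c0 fc; rewrite -[leRHS]rootK // /rademacher_norm.
have int0 : 0 <= \int[mu]_(w in D) f w by apply: Rintegral_ge0 => w _; exact: powR_ge0.
apply: ge0_ler_powR; rewrite ?nnegrE ?powR_ge0 ?invr_ge0 ?(ltW p_gt0) //.
by apply: (fine_le integral_fin (y := (c `^ p)%:E)) => //; exact: integral_le.
Qed.

(** Points where some Rademacher function vanishes have to be left out: there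
    the sum loses a term, and the lower bound used later fails. *)
Lemma le_rademacher_norm c : 0 <= c ->
  (forall w, (forall k, rademacher k w != 0) -> c <= rnorm (rademacher_sum x w)) ->
  c <= rademacher_norm p x.
Proof.
move=> c0 cf; rewrite -[leLHS]rootK // /rademacher_norm.
have int0 : 0 <= \int[mu]_(w in D) f w by apply: Rintegral_ge0 => w _; exact: powR_ge0.
apply: ge0_ler_powR; rewrite ?nnegrE ?powR_ge0 ?invr_ge0 ?(ltW p_gt0) //.
apply: (fine_le (x := (c `^ p)%:E) _ integral_fin) => //=.
have -> : (c `^ p)%:E = (\int[mu]_(w in D) cst (c `^ p)%:E w)%E.
  by rewrite integral_cst // -[LHS]mule1; congr (_ * _)%E; exact/esym/muD.
apply: ae_ge0_le_integral => // [w _|w _|]; rewrite ?lee_fin ?powR_ge0 //.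
have [N [mN N0 subN]] := rademacher_neq0_ae.
exists N; split => // w /= not_le; apply: subN => /= w_neq0; apply: not_le => Dw.
rewrite lee_fin; apply: ge0_ler_powR; rewrite ?nnegrE ?rnorm_ge0 ?(ltW p_gt0) //.
by apply: cf; exact: w_neq0.
Qed.

End Bounds.
End Rademacher.

(** * Signs and rearrangements of an unconditional basis *)

Section SignsAndRearrangements.
Context {R : realType} {X : completeNormedModType R[i]}.
Variables (e : nat -> X) (e_unc : unconditional_basis e) (e_norm : normalized e).
Let e_basis : schauder_basis e := e_unc.1.
Implicit Types (x y : X) (s t : seq nat) (a : nat -> R[i]).
Local Notation proj := (finite_proj e).

Lemma finite_proj_vec s j : uniq s -> proj s (e j) = (j \in s)%:R *: e j.
Proof.
move=> s_uniq; rewrite /finite_proj.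
under eq_bigr => m _ do rewrite coefficients_vec //.
have [js|js] := boolP (j \in s).
  rewrite (bigD1_seq j) //= eqxx scale1r big1 ?addr0 // => m /negbTE->.
  by rewrite scale0r.
rewrite scale0r big_seq big1 // => m ms.
by case: eqP ms js => [->->//|_ _ _]; rewrite scale0r.
Qed.

Lemma finite_proj_sum s t a : uniq s ->
  proj s (\sum_(j <- t) a j *: e j) = \sum_(j <- t | j \in s) a j *: e j.
Proof.
move=> s_uniq; elim: t => [|j t IHt]; first by rewrite !big_nil finite_proj0.
rewrite !big_cons finite_projD // finite_projZ // finite_proj_vec // IHt.
by case: (j \in s); rewrite ?scale1r // scale0r scaler0 add0r.
Qed.

Variables (K : R) (K_gt0 : 0 < K).
Hypothesis proj_le : forall s x, uniq s -> rnorm (proj s x) <= K * rnorm x.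

Lemma subset_sum_le (P : pred nat) s a : uniq s ->
  rnorm (\sum_(j <- s | P j) a j *: e j) <= K * rnorm (\sum_(j <- s) a j *: e j).
Proof.
move=> s_uniq; have Ps_uniq : uniq [seq j <- s | P j] by rewrite filter_uniq.
have <- : proj [seq j <- s | P j] (\sum_(j <- s) a j *: e j) =
    \sum_(j <- s | P j) a j *: e j.
  rewrite finite_proj_sum // big_seq_cond [RHS]big_seq_cond.
  by apply: eq_bigl => j; rewrite mem_filter; case: (j \in s); rewrite ?andbT.
exact: proj_le.
Qed.

(** A signed sum is the difference of its positive and its negative part, which
    are both images of the unsigned sum under finite projections. *)
Lemma signed_sum_le (theta : nat -> R) s a : uniq s ->
  (forall j, Num.sg (theta j) = theta j) ->
  rnorm (\sum_(j <- s) (theta j)%:C%C *: (a j *: e j)) <=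
    2 * K * rnorm (\sum_(j <- s) a j *: e j).
Proof.
move=> s_uniq theta_sg.
have -> : \sum_(j <- s) (theta j)%:C%C *: (a j *: e j) =
    \sum_(j <- s | 0 < theta j) a j *: e j - \sum_(j <- s | theta j < 0) a j *: e j.
  rewrite !(big_mkcond (fun j => _ < _)) -sumrB; apply: eq_bigr => j _.
  rewrite -theta_sg; case: sgrP => _.
  - by rewrite ltxx rmorph0 scale0r subr0.
  - by rewrite ltr01 ltr10 rmorph1 scale1r subr0.
  - by rewrite oppr_gt0 oppr_lt0 ltr01 ltr10 rmorphN1 scaleN1r sub0r.
apply: le_trans (rnormB _ _) _.
have := subset_sum_le (fun j => 0 < theta j) a s_uniq.
have := subset_sum_le (fun j => theta j < 0) a s_uniq.
by lra.
Qed.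

Lemma coefficients_le x j : cabs (coefficients e x j) <= K * rnorm x.
Proof.
have := @proj_le [:: j] x isT.
by rewrite /finite_proj big_seq1 rnormZ rnorm_basis // mulr1.
Qed.

(** Continuity of the coordinate functionals of e, in the form that identifies
    coefficients from an expansion in any other sequence h. *)
Lemma coefficients_limit (h : nat -> X) x b j (c : R[i]) : expansion h x b ->
  (exists N, forall n, (N <= n)%N ->
     coefficients e (\sum_(0 <= m < n) b m *: h m) j = c) ->
  coefficients e x j = c.
Proof.
move=> /expansionP xb [N Nc]; apply/eqP; rewrite -subr_eq0 -normr_eq0 cabsE.
suff -> : cabs (coefficients e x j - c) = 0 by [].
apply/eqP; rewrite eq_le cabs_ge0 andbT; apply/ler_addgt0Pl => eps eps0; rewrite addr0.
have [M MP] := xb _ (divr_gt0 eps0 K_gt0).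
have := coefficients_le (x - \sum_(0 <= m < maxn N M) b m *: h m) j.
rewrite coefficientsB // Nc ?leq_maxl // => le_K.
apply: le_trans le_K _; rewrite mulrC -ler_pdivlMr //; exact/ltW/MP/leq_maxr.
Qed.

(** The rearranged series converges to the same sum: once s contains
    {0, ..., N-1}, the projection onto s fixes the N-th partial sum y of x, so
    x - P_s x = (x - y) - P_s (x - y) is small with x - y. *)
Lemma expansion_rearranged (rho r : nat -> nat) x a :
  cancel rho r -> cancel r rho -> expansion e x a ->
  expansion (e \o rho) x (a \o rho).
Proof.
move=> rhoK rK xa; have aE := coefficients_unique e_basis xa.
apply/expansionP => eps eps0.
have K1 : 0 < 1 + K by rewrite addr_gt0.
have [N NP] := (expansionP _ _ _).1 xa _ (divr_gt0 eps0 K1).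
exists (\max_(j < N) r j).+1 => n n_large.
pose s := map rho (index_iota 0 n).
have s_uniq : uniq s by rewrite map_inj_uniq ?iota_uniq //; exact: can_inj rhoK.
have -> : \sum_(0 <= m < n) (a \o rho) m *: (e \o rho) m = proj s x.
  by rewrite /finite_proj big_map aE.
set y := \sum_(0 <= j < N) a j *: e j.
have proj_y : proj s y = y.
  rewrite finite_proj_sum // big_seq_cond [RHS]big_seq; apply: eq_bigl => j.
  rewrite mem_index_iota /=; case: (ltnP j N) => //= jN.
  apply/mapP; exists (r j); rewrite ?rK // mem_index_iota /=.
  exact: leq_ltn_trans (leq_bigmax (Ordinal jN)) n_large.
have -> : x - proj s x = (x - y) - proj s (x - y).
  by rewrite finite_projB // proj_y opprB addrA subrK.
apply: le_lt_trans (rnormB _ _) _.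
have := proj_le (x - y) s_uniq; have := NP N (leqnn _).
by rewrite ltr_pdivlMr // -/y; lra.
Qed.

End SignsAndRearrangements.

(** * Bases obtained by merging pairs of vectors *)

Section PairBasis.
Context {R : realType} {X : completeNormedModType R[i]}.
Variables (e : nat -> X) (e_unc : unconditional_basis e) (e_norm : normalized e).
Let e_basis : schauder_basis e := e_unc.1.
Variables (K : R) (K_gt0 : 0 < K).
Hypothesis proj_le : forall s x, uniq s -> rnorm (finite_proj e s x) <= K * rnorm x.
Variables (rho r : nat -> nat) (rhoK : cancel rho r) (rK : cancel r rho).
Variables (t : pred nat) (t0 : t 0%N = false).
Hypothesis t_isolated : forall m, t m.+1 -> t m = false.

(** Here t marks the positions that absorb their predecessor; marked positions
    are isolated, so that each unmarked vector is absorbed at most once and is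
    itself a vector of the new sequence. *)
Definition pair_basis m : X := e (rho m) + (t m)%:R *: e (rho m.-1).
Local Notation f := pair_basis.

Let coef x m := coefficients e x (rho m).

Definition pair_coefficients (b : nat -> R[i]) m : R[i] :=
  b m - (t m.+1)%:R * b m.+1.

(** Summation by parts: the two partial sums agree except when n cuts a pair
    into its two members. *)
Lemma pair_partial_sum b n :
  \sum_(0 <= m < n) pair_coefficients b m *: f m =
  \sum_(0 <= m < n) b m *: e (rho m) - (t n)%:R *: (b n *: e (rho n.-1)).
Proof.
elim: n => [|n IHn]; first by rewrite !big_geq // t0 scale0r subr0.
rewrite !big_nat_recr //= IHn /pair_coefficients /pair_basis.
case: (boolP (t n.+1)) => [/t_isolated->|_]; rewrite ?scale0r ?mul0r ?subr0 ?addr0.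
  by rewrite scale1r mul1r scalerBl addrA.
case: (t n); rewrite ?scale1r ?scale0r ?subr0 ?addr0 //.
by rewrite scalerDr [_ *: e (rho n) + _]addrC addrA subrK.
Qed.

Lemma coefficients_permuted_sum b n j :
  coefficients e (\sum_(0 <= m < n) b m *: e (rho m)) (rho j) =
  if (j < n)%N then b j else 0.
Proof.
elim: n => [|n IHn].
  by rewrite big_geq // -(scale0r 0) coefficientsZ // mul0r.
rewrite big_nat_recr //= coefficientsD // IHn coefficientsZ // coefficients_vec //.
rewrite (can_eq rhoK) ltnS [in RHS]leq_eqVlt; case: eqP => [->|_] /=.
  by rewrite ltnn add0r mulr1.
by rewrite mulr0 addr0.
Qed.

Lemma pair_expansion x : expansion f x (pair_coefficients (coef x)).
Proof.
have /expansionP xb := expansion_rearranged e_unc K_gt0 proj_le rhoK rK (coefficientsP e_basis x).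
apply/expansionP => eps eps0.
have eps3 : 0 < eps / 3 by rewrite divr_gt0.
have [N NP] := xb _ eps3; exists N => n Nn; rewrite pair_partial_sum.
have := NP n Nn; have := NP n.+1 (leqW Nn); rewrite big_nat_recr //=.
set S := \sum_(0 <= m < n) _; rewrite -[S in _ -> _ -> rnorm (_ - (S - _)) < _]/S.
move=> xS1 xS.
have coef_small : rnorm (coef x n *: e (rho n)) < eps / 3 + eps / 3.
  have -> : coef x n *: e (rho n) = (x - S) - (x - (S + coef x n *: e (rho n))).
    by rewrite opprB addrC addrA addrNK; rewrite addrC addKr.
  exact: le_lt_trans (rnormB _ _) (ltrD xS xS1).
rewrite opprB addrCA addrC; apply: le_lt_trans (rnormD _ _) _.
have : rnorm ((t n)%:R *: (coef x n *: e (rho n.-1))) <= rnorm (coef x n *: e (rho n)).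
  case: (t n); rewrite ?scale1r ?scale0r ?rnorm0 ?rnorm_ge0 //.
  by rewrite !rnormZ !rnorm_basis.
by lra.
Qed.

(** The map pair_coefficients is onto: a marked position is followed by an
    unmarked one, so it is inverted by changing the sign of its correction
    term.  Hence every expansion in the new sequence comes from
    coefficients b with respect to e o rho, and these are read off by the
    coordinate functionals of e. *)
Lemma pair_coefficients_unique x c : expansion f x c ->
  pair_coefficients (coef x) = c.
Proof.
pose b m := c m + (t m.+1)%:R * c m.+1.
have -> : c = pair_coefficients b.
  apply/funext => j; rewrite /pair_coefficients /b.
  case: (boolP (t j.+1)) => [tj|_]; last by rewrite !mul0r addr0 subr0.
  case: (boolP (t j.+2)) => [/t_isolated|_]; first by rewrite tj.
  by rewrite !mul1r mul0r addr0 addrK.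
move=> xb; congr pair_coefficients; apply/funext => j.
apply: (coefficients_limit e_unc e_norm K_gt0 proj_le xb); exists j.+2 => n jn.
rewrite pair_partial_sum coefficientsB // !coefficientsZ //.
rewrite coefficients_permuted_sum ltnW // coefficients_vec // (can_eq rhoK).
by rewrite ltn_eqF ?mulr0 ?subr0 // ltn_predRL.
Qed.

Lemma pair_schauder_basis : schauder_basis f.
Proof.
move=> x; exists (pair_coefficients (coef x)); split; first exact: pair_expansion.
exact: pair_coefficients_unique.
Qed.

(** Cutting a pair: as e (rho n) = f n - f n.-1, only the term - f n.-1 comes
    before position n. *)
Lemma pair_basis_proj n lambda : t n ->
  basis_proj f n (lambda *: e (rho n)) = - (lambda *: e (rho n.-1)).
Proof.
move=> tn; rewrite /basis_proj.
rewrite (coefficients_unique pair_schauder_basis (@pair_expansion _)).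
have coefE m : coef (lambda *: e (rho n)) m = lambda * (m == n)%:R.
  by rewrite /coef coefficientsZ // coefficients_vec // (can_eq rhoK).
rewrite -(big_mkord xpredT (fun m => pair_coefficients (coef (lambda *: e (rho n))) m *: f m)).
rewrite pair_partial_sum tn scale1r coefE eqxx mulr1 big_nat big1 ?sub0r // => m /andP[_ mn].
by rewrite coefE ltn_eqF // mulr0 scale0r.
Qed.

End PairBasis.

(** * From R-boundedness to symmetry *)

Section Domination.
Context {R : realType} {X : completeNormedModType R[i]}.
Variables (e : nat -> X) (e_unc : unconditional_basis e) (e_norm : normalized e).
Let e_basis : schauder_basis e := e_unc.1.
Variables (K : R) (K_gt0 : 0 < K).
Hypothesis proj_le : forall s x, uniq s -> rnorm (finite_proj e s x) <= K * rnorm x.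
Implicit Types (s : seq nat) (a : nat -> R[i]) (S P Q : pred nat).

Definition dominated (p : nat -> nat) P : Prop := exists2 C : R, 0 < C &
  forall s a, uniq s ->
    rnorm (\sum_(j <- s | P j) a j *: e (p j)) <= C * rnorm (\sum_(j <- s) a j *: e j).

Lemma dominated_split p P Q :
  dominated p (fun j => P j && Q j) -> dominated p (fun j => P j && ~~ Q j) ->
  dominated p P.
Proof.
move=> [C C0 CP] [D D0 DP]; exists (C + D) => [|s a s_uniq]; first exact: addr_gt0.
rewrite (bigID Q) /= mulrDl; apply: le_trans (rnormD _ _) _.
by rewrite lerD ?CP ?DP.
Qed.

Section OneClass.
Variables (p q : nat -> nat) (pK : cancel p q) (qK : cancel q p).
Variables (S : pred nat) (SpS : forall j, S j -> ~~ S (p j)).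

Lemma pairing_basis : exists f, schauder_basis f /\
  forall j, S j -> exists2 N, (0 < N)%N &
    forall lambda, basis_proj f N (lambda *: e j) = - (lambda *: e (p j)).
Proof.
have [rho [r [rhoK rK r_next]]] := enumerate_pairs pK qK SpS.
pose t m := S (rho m).
have t0 : t 0%N = false.
  by apply/negbTE/negP => /r_next; rewrite rhoK.
have prev m : t m.+1 -> rho m = p (rho m.+1).
  by move=> /r_next; rewrite rhoK => -[mE]; rewrite [in LHS]mE rK.
have t_isolated m : t m.+1 -> t m = false.
  by move=> tm; rewrite /t (prev _ tm); apply/negbTE/SpS.
exists (pair_basis e rho t); split.
  exact: (pair_schauder_basis e_unc e_norm K_gt0 proj_le rhoK rK t0 t_isolated).
move=> j Sj; exists (r j) => [|lambda]; first by rewrite r_next.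
have tj : t (r j) by rewrite /t rK.
have := pair_basis_proj e_unc e_norm K_gt0 proj_le rhoK rK t0 t_isolated lambda tj.
by rewrite rK r_next //= rK.
Qed.

Hypothesis all_R_basis : forall f : nat -> X, schauder_basis f -> R_basis f.

(** R-boundedness is applied to the projections that send e_v to - e_(p v).
    Both Rademacher averages are then compared pointwise with unsigned sums;
    on the side of the e_(p v), multiplying by the signs once more undoes
    them wherever no sign is 0. *)
Lemma R_basis_dominated : dominated p S.
Proof.
have [f [f_basis f_proj]] := pairing_basis.
have [c c1 [C C0 RP]] := all_R_basis f_basis.
exists (2 * K * (C * (2 * K * K))) => [|s a s_uniq]; first by rewrite !mulr_gt0.
pose s' := [seq j <- s | S j]; have s'_uniq : uniq s' by rewrite filter_uniq.
have /choice[N NP] : forall j, exists N, S j -> (0 < N)%N /\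
    forall lambda, basis_proj f N (lambda *: e j) = - (lambda *: e (p j)).
  move=> j; have [/f_proj[N N0 NP]|_] := boolP (S j); first by exists N.
  by exists 0%N.
pose v (k : 'I_(size s')) := nth 0%N s' k.
have Sv k : S (v k).
  by have := mem_nth 0%N (ltn_ord k); rewrite mem_filter => /andP[].
pose x k := a (v k) *: e (v k).
have := RP _ (fun k => basis_proj f (N (v k))) x.
have -> : (fun k => basis_proj f (N (v k)) (x k)) = (fun k => - (a (v k) *: e (p (v k)))).
  by apply/funext => k; rewrite (NP _ (Sv k)).2.
move=> /(_ (fun k => ex_intro2 _ _ (N (v k)) (NP _ (Sv k)).1 erefl)).
pose theta w j := rademacher (index j s').+1 w : R.
have theta_sg w j : Num.sg (theta w j) = theta w j by rewrite /theta /rademacher sgr_id.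
have sumE (F : nat -> X) w : rademacher_sum (fun k => F (v k)) w =
    \sum_(j <- s') (theta w j)%:C%C *: F j.
  rewrite (big_nth 0%N) big_mkord; apply: eq_bigr => k _.
  by rewrite /theta index_uniq.
set A := rnorm (\sum_(j <- s) a j *: e j).
set B := rnorm (\sum_(j <- s | S j) a j *: e (p j)).
have A0 : 0 <= A by exact: rnorm_ge0.
have K2 : 0 < 2 * K by rewrite mulr_gt0.
have upper : rademacher_norm c x <= 2 * K * K * A.
  apply: rademacher_norm_le => // [|w]; first by rewrite !mulr_ge0 // ltW.
  rewrite (sumE (fun j => a j *: e j)).
  apply: le_trans (signed_sum_le e_unc proj_le a s'_uniq (theta_sg w)) _.
  rewrite -[leRHS]mulrA ler_pM2l // big_filter.
  exact: (subset_sum_le e_unc proj_le).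
have lower : B / (2 * K) <= rademacher_norm c (fun k => - (a (v k) *: e (p (v k)))).
  apply: le_rademacher_norm => // [|w w_neq0].
    by rewrite divr_ge0 ?rnorm_ge0 // ltW.
  rewrite (sumE (fun j => - (a j *: e (p j)))) ler_pdivrMr // mulrC.
  (* Indexed by i = p j, these are the coefficients of the signed sum; applying
     the signs a second time restores a. *)
  pose b i := - ((theta w (q i))%:C%C * a (q i)).
  have ps_uniq : uniq (map p s') by rewrite map_inj_uniq //; exact: can_inj pK.
  have := signed_sum_le e_unc proj_le b ps_uniq (fun i => theta_sg w (q i)).
  rewrite !big_map.
  under eq_bigr => j _.
    rewrite /b pK scalerA mulrN mulrA -rmorphM /= -expr2.
    have -> : theta w j ^+ 2 = 1.
      by rewrite -theta_sg sqr_sg w_neq0.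
    rewrite mul1r scaleNr; over.
  rewrite sumrN rnormN big_filter -/B.
  under eq_bigr => j _.
    rewrite /b pK -mulrN -scalerA scaleNr; over.
  by [].
move=> TxCx; have := le_trans lower (le_trans TxCx _).
move=> /(_ (C * (2 * K * K * A))); rewrite ler_pM2l // => /(_ upper).
by rewrite ler_pdivrMr // mulrC !mulrA.
Qed.

End OneClass.

Hypothesis all_R_basis : forall f : nat -> X, schauder_basis f -> R_basis f.

Lemma dominated_excedances p q : cancel p q -> cancel q p ->
  dominated p (fun j => j < p j)%N.
Proof.
move=> pK qK; have [h hP] := excedance_parity pK.
apply: (@dominated_split _ _ h); apply: (R_basis_dominated pK qK) => // j /andP[jp hj];
  by rewrite hP // hj andbF.
Qed.

Lemma dominated_deficiencies p q : cancel p q -> cancel q p ->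
  dominated p (fun j => p j < j)%N.
Proof.
move=> pK qK; have [h hP] := excedance_parity qK.
have hpj j : (p j < j)%N -> h j = ~~ h (p j) by move=> pj; rewrite -hP pK.
by apply: (@dominated_split _ _ h); apply: (R_basis_dominated pK qK) => // j /andP[/hpj hj];
  rewrite hj; case: (h (p j)); rewrite ?andbF.
Qed.

Lemma permutation_dominated p q : cancel p q -> cancel q p -> dominated p predT.
Proof.
move=> pK qK.
apply: (@dominated_split _ _ (fun j => j < p j)%N).
  exact: dominated_excedances pK qK.
apply: (@dominated_split _ _ (fun j => p j < j)%N).
  have [C C0 CP] := dominated_deficiencies pK qK; exists C => // s a s_uniq.
  by rewrite (eq_bigl (fun j => (p j < j)%N)) ?CP // => j; case: ltngtP.
exists K => // s a s_uniq.
have -> : \sum_(j <- s | (predT j && ~~ (j < p j)%N) && ~~ (p j < j)%N) a j *: e (p j) =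
    \sum_(j <- s | p j == j) a j *: e j.
  rewrite (eq_bigl (fun j => p j == j)) => [|j /=]; last by case: ltngtP.
  by apply: eq_bigr => j /eqP->.
exact: subset_sum_le.
Qed.

Lemma series_transfer (u v : nat -> X) C : 0 < C ->
  (forall m n, (m <= n)%N ->
     rnorm (\sum_(m <= k < n) u k) <= C * rnorm (\sum_(m <= k < n) v k)) ->
  cvgn (series v) -> cvgn (series u).
Proof.
move=> C0 uv v_cvg; apply: cauchy_rnorm_cvgn => eps eps0.
have [N NP] := cvgn_rnorm_cauchy v_cvg (divr_gt0 eps0 C0).
exists N => m n; wlog mn : m n / (m <= n)%N.
  by move=> wl Nm Nn; have [/wl->//|/ltnW nm] := leqP m n; rewrite rnorm_distC wl.
move=> Nm Nn; rewrite rnorm_distC sub_series_geq //; apply: le_lt_trans (uv _ _ mn) _.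
by rewrite mulrC -ltr_pdivlMr // -sub_series_geq // NP.
Qed.

Lemma all_R_basis_symmetric : symmetric_basis e.
Proof.
split=> // p [q pK qK] a.
have [C C0 CP] := permutation_dominated pK qK.
have [D D0 DP] := permutation_dominated qK pK.
split; [apply: (series_transfer C0)|apply: (series_transfer D0)] => m n mn.
  exact: CP (iota_uniq _ _).
have p_uniq : uniq (map p (index_iota m n)).
  by rewrite map_inj_uniq ?iota_uniq //; exact: can_inj pK.
have := DP _ (a \o q) p_uniq; rewrite !big_map.
rewrite (eq_bigr (fun j => a j *: e j)) => [|j _]; last by rewrite /= pK.
rewrite [X in _ <= _ * rnorm X](eq_bigr (fun j => a j *: e (p j))) // => j _.
by rewrite /= pK.
Qed.

End Domination.

Theorem theorem7p2 (R : realType) (X : completeNormedModType R[i])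
    (X_infdim : infinite_dimensional X)
    (e : nat -> X)
    (e_unconditional : unconditional_basis e)
    (e_nonsymmetric : ~ symmetric_basis e)
    (e_normalized : normalized e) :
  exists f : nat -> X, schauder_basis f /\ ~ R_basis f.
Proof.
apply: contrapT => no_f; apply: e_nonsymmetric.
have [K K0 KP] := unconditional_constant e_unconditional e_normalized.
apply: (all_R_basis_symmetric e_unconditional e_normalized K0 KP) => f f_basis.
by apply: contrapT => f_not_R; apply: no_f; exists f.
Qed.
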